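(* For every integer $n\ge 0$, as polynomials in $x$ and $y$, $$B_{n}^{L}(x,y)=\sum_{k=0}^{n}(-1)^{n-k}S_{1}(n,k)B_{k}(x,y)$$ and $$B_{n}(x,y)=\sum_{k=0}^{n}(-1)^{n-k}S_{2}(n,k)B_{k}^{L}(x,y).$$
   Context: The falling factorial is $(x)_0=1$ and $(x)_n=x(x-1)\cdots(x-n+1)$ for $n\ge 1$. The Stirling numbers of the first kind $S_1(n,k)$ (signed) are defined by $(x)_n=\sum_{k=0}^n S_1(n,k)x^k$. $S_2(n,k)$ is the Stirling number of the second kind: the number of ways to partition a set of $n$ elements into $k$ nonempty subsets. For integers $n,k\ge 0$, the unsigned Lah number $L(n,k)$ is the number of ways a set of $n$ elements can be partitioned into $k$ nonempty linearly ordered subsets (so $L(0,0)=1$, $L(n,0)=0$ for $n\ge 1$, $L(n,k)=0$ for $k>n$, and $L(n,k)=\binom{n-1}{k-1}\frac{n!}{k!}$ for $n\ge k\ge 1$). The bivariate Bell polynomials are $B_n(x,y)=\sum_{k=0}^n S_2(n,k)(x)_k y^k$, and the bivariate Lah-Bell polynomials are $B_n^L(x,y)=\sum_{k=0}^n L(n,k)(x)_k y^k$, for $n\ge 0$. *)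

(* Defs.v *)
From HB Require Import structures.
From mathcomp Require Import all_boot all_order all_algebra.
From mathcomp Require Import mpoly.

Set Implicit Arguments.
Unset Strict Implicit.
Unset Printing Implicit Defensive.

Import GRing.Theory.
Local Open Scope ring_scope.

(* The falling factorial (x)_n = x (x - 1) ... (x - n + 1). *)
Definition falling (R : pzRingType) (x : R) (n : nat) : R :=
  \prod_(i < n) (x - i%:R).

Definition S1 (n k : nat) : int := (falling ('X : {poly int}) n)`_k.

Lemma fallingX_S1 n :
  falling ('X : {poly int}) n = \sum_(k < n.+1) (S1 n k)%:P * 'X^k.
Proof.
have szE : (size (falling ('X : {poly int}) n) <= n.+1)%N.
  rewrite /falling; under eq_bigr => i _ do rewrite -polyC_natr.
  by rewrite size_prod_XsubC -[index_enum _]enumT size_enum_ord.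
rewrite -[LHS]coefK (poly_def (size _)).
under [RHS]eq_bigr => k _ do rewrite mul_polyC.
by rewrite (big_ord_widen _ (fun k => (falling 'X n)`_k *: 'X^k) szE) big_mkcond;
  apply: eq_bigr => k _; case: ltnP => // /(nth_default 0) skn;
  rewrite /S1 skn scale0r.
Qed.

Definition S2 (n k : nat) : nat :=
  #|[set P : {set {set 'I_n}} | partition P [set: 'I_n] & #|P| == k]|.

(* A linearly ordered nonempty subset of T is encoded as the duplicate-free
   nonempty sequence listing its elements in increasing order; such a sequence
   has at most #|T| terms, so bounding the length loses nothing. A partition of
   T into such subsets is a set Q of sequences such that every x : T occurs in
   exactly one of them. *)
Definition ordered_partition (T : finType) (Q : {set {bseq #|T| of T}}) : bool :=
  [forall s in Q, (0 < size s)%N && uniq s]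
  && [forall x : T, #|[set s in Q | x \in (s : seq T)]| == 1%N].

Definition Lah (n k : nat) : nat :=
  #|[set Q : {set {bseq #|'I_n| of 'I_n}} | ordered_partition Q & #|Q| == k]|.

(* In {mpoly R[2]}, the indeterminates x and y are 'X_0 and 'X_1. *)
Definition bell2 (R : comNzRingType) (n : nat) : {mpoly R[2]} :=
  \sum_(k < n.+1) (S2 n k)%:R * falling 'X_0 k * 'X_1 ^+ k.

Definition lahbell2 (R : comNzRingType) (n : nat) : {mpoly R[2]} :=
  \sum_(k < n.+1) (Lah n k)%:R * falling 'X_0 k * 'X_1 ^+ k.

(* Main.v *)
Require Import Defs.
From HB Require Import structures.
From mathcomp Require Import all_boot all_order all_algebra.
From mathcomp Require Import mpoly zify.

Set Implicit Arguments.
Unset Strict Implicit.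
Unset Printing Implicit Defensive.

Import GRing.Theory.
Local Open Scope ring_scope.

(** Give m poles. A function from an n-set to the poles is a set partition
    (its nonempty fibres) together with an injection of the blocks into the
    poles, so m ^ n = sum_k S2(n,k) (m)_k. Likewise, hanging n distinct flags on
    the poles, the order along each pole being relevant, is an ordered partition
    together with an injection of its lists into the poles; reading the poles
    one after the other, it is also a permutation of the flags together with a
    composition of n into m parts. Hence
      sum_k L(n,k) (m)_k = m (m + 1) ... (m + n - 1) = (-1)^n (-m)_n.
    Both counts are instances of one double count, [card_placements].

    As polynomials, therefore, x^n = sum_k S2(n,k) (x)_k and
    (-1)^n (-x)_n = sum_k L(n,k) (x)_k. Expanding (-x)_n in powers of -x by the
    definition of S1, and then those powers of x by S2, expresses the second
    polynomial through the falling factorials; expanding (-x)^n in the (-x)_k by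
    S2, and then those by L, does the same for the first. These are the two
    claimed identities with (x)_j in place of (x)_j y^j. Since the falling
    factorials are linearly independent, (x)_j may be replaced by any sequence
    w_j of a ring ([umbral_transfer]), in particular by (x)_j y^j. *)

(** * Exact covers and their distributions over a set of poles *)

Section DoubleCount.

Local Open Scope nat_scope.

(* A piece s : X occupies the points supp s of T; e is the empty piece, and
   good says which elements of X are admissible as pieces. *)
Variables (T X : finType) (supp : X -> {set T}) (good : pred X) (e : X).

(** Set partitions, for X the subsets of T, and ordered partitions, for X the
    bounded sequences over T. *)
Definition exact_cover (Q : {set X}) : bool :=
  [forall s in Q, good s && (s != e)]
  && [forall x : T, #|[set s in Q | x \in supp s]| == 1].

(** Unlike a cover, a placement may use the empty piece, any number of times. *)
Definition placement (I : finType) (g : {ffun I -> X}) : bool :=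
  [forall i, good (g i)] && [forall x : T, #|[set i | x \in supp (g i)]| == 1].

Definition used_pieces (I : finType) (g : {ffun I -> X}) : {set X} :=
  [set g i | i in I] :\ e.

Hypothesis good_e : good e.
Hypothesis supp_e : supp e = set0.
Hypothesis supp_eq0 : forall s, good s -> supp s = set0 -> s = e.

(** The supports of the pieces are nonempty, and their sizes add up to #|T|. *)
Lemma exact_cover_card Q : exact_cover Q -> #|Q| <= #|T|.
Proof.
move=> /andP[/forall_inP Qgood /forallP Qcov].
have -> : #|T| = \sum_(s in Q) #|supp s|.
  under eq_bigr => s _ do rewrite -sum1_card.
  rewrite (exchange_big_dep xpredT) //= -sum1_card.
  apply: eq_bigr => x _; rewrite sum1dep_card; apply/esym/eqP.
  by rewrite -(eqP (Qcov x)).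
rewrite -sum1_card; apply: leq_sum => s /Qgood /andP[gs sNe].
by rewrite card_gt0; apply: contraNneq sNe => /(supp_eq0 gs) ->.
Qed.

Section Poles.

Variable I : finType.

(** A nonempty piece covers some point, and that point determines its pole. *)
Lemma placement_inj (g : {ffun I -> X}) i j :
  placement g -> g i != e -> g i = g j -> i = j.
Proof.
move=> /andP[/forallP good_g /forallP cov_g] giNe eq_g.
have [x xi] : exists x, x \in supp (g i).
  by apply/set0Pn; apply: contraNneq giNe => /(supp_eq0 (good_g i)) ->.
have /cards1P[k Dk] := cov_g x.
have: i \in [set i | x \in supp (g i)] by rewrite inE.
have: j \in [set i | x \in supp (g i)] by rewrite inE -eq_g.
by rewrite Dk !inE => /eqP-> /eqP->.
Qed.

Lemma used_pieces_cover (g : {ffun I -> X}) :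
  placement g -> exact_cover (used_pieces g).
Proof.
move=> /andP[/forallP good_g /forallP cov_g]; apply/andP; split.
  by apply/forall_inP=> s /setD1P[sNe /imsetP[i _ Ds]]; rewrite sNe Ds good_g.
apply/forallP=> x; have /cards1P[k Dk] := cov_g x.
have memk i : (x \in supp (g i)) = (i == k).
  by have /setP/(_ i) := Dk; rewrite !inE.
apply/cards1P; exists (g k); apply/setP=> s; rewrite !inE.
apply/andP/eqP => [[/andP[_ /imsetP[i _ ->]]] | ->].
  by rewrite memk => /eqP->.
rewrite memk eqxx imset_f // andbT; split=> //.
by apply: contraTneq (eqxx k) => gke; rewrite -memk gke supp_e inE.
Qed.

Section Fiber.

Variable Q : {set X}.
Hypothesis Qcover : exact_cover Q.

(** Only meaningful for injective h, which [pick] then inverts. *)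
Definition place (h : {ffun {s | s \in Q} -> I}) : {ffun I -> X} :=
  [ffun i => if [pick s | h s == i] is Some s then val s else e].

Lemma place_at (h : {ffun {s | s \in Q} -> I}) s : injectiveb h -> place h (h s) = val s.
Proof.
move=> /injectiveP h_inj; rewrite ffunE.
by case: pickP => [t /eqP/h_inj-> // | /(_ s)]; rewrite eqxx.
Qed.

Lemma place_inj : {in [pred h : {ffun _ -> _} | injectiveb h] &, injective place}.
Proof.
move=> h k hi ki eq_hk; apply/ffunP=> s; have := place_at s ki.
rewrite -eq_hk ffunE; case: pickP => [t /eqP <- /val_inj-> //|_ eE].
have /andP[/forall_inP/(_ _ (valP s))/andP[_]] := Qcover.
by rewrite -eE eqxx.
Qed.

Lemma placeP (h : {ffun {s | s \in Q} -> I}) :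
  injectiveb h -> placement (place h) && (used_pieces (place h) == Q).
Proof.
move=> hi; have /andP[/forall_inP Qgood /forallP Qcov] := Qcover.
have h_inj := injectiveP _ hi.
apply/andP; split; last first.
  apply/eqP/setP=> s; rewrite !inE; apply/andP/idP => [[sNe /imsetP[i _]]|sQ].
    by rewrite ffunE; case: pickP => [t _ ->|_ se]; [apply: valP | rewrite se eqxx in sNe].
  have /andP[_ ->] := Qgood s sQ; split=> //.
  by apply/imsetP; exists (h (Sub s sQ)); rewrite ?place_at.
apply/andP; split; apply/forallP.
  move=> i; rewrite ffunE; case: pickP => [t _|_]; last exact: good_e.
  by have /andP[] := Qgood _ (valP t).
move=> x; have /cards1P[s Ds] := Qcov x.
have /[!inE]/andP[sQ xs] : s \in [set s in Q | x \in supp s] by rewrite Ds inE.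
apply/cards1P; exists (h (Sub s sQ)); apply/setP=> i; rewrite !inE.
apply/idP/eqP => [|->]; last by rewrite place_at.
rewrite ffunE; case: pickP => [t /eqP <- xt|]; last by rewrite supp_e inE.
congr (h _); apply: val_inj => /=; apply/set1P; rewrite -Ds inE xt andbT.
exact: valP.
Qed.

Lemma place_onto g :
    placement g -> used_pieces g = Q ->
  exists2 h : {ffun {s | s \in Q} -> I}, injectiveb h & g = place h.
Proof.
move=> Pg Qg; have /andP[/forall_inP Qgood _] := Qcover.
have [h hP] : exists h : {s | s \in Q} -> I, forall s, g (h s) = val s.
  apply: (@fin_all_exists _ (fun=> I) (fun s i => g i = val s)) => s.
  have /setD1P[_ /imsetP[i _ ->]] : val s \in used_pieces g by rewrite Qg; exact: (valP s).
  by exists i.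
have hi : injectiveb (finfun h).
  by apply/injectiveP=> s t; rewrite !ffunE => /(congr1 g); rewrite !hP => /val_inj.
exists (finfun h) => //; apply/ffunP=> i.
have [gie | giNe] := eqVneq (g i) e.
  rewrite ffunE; case: pickP => // s; rewrite ffunE => /eqP his.
  by have /andP[_ /eqP[]] := Qgood _ (valP s); rewrite -hP his.
have giQ : g i \in Q by rewrite -Qg in_setD1 giNe imset_f.
have -> : i = finfun h (Sub (g i) giQ).
  by rewrite ffunE; apply: (placement_inj Pg giNe); rewrite hP.
by rewrite place_at // ffunE hP.
Qed.

(** The placements with set of nonempty pieces Q correspond, through [place], to
    the injections of Q into the poles. *)
Lemma card_placements_using :
  #|[set g : {ffun I -> X} | placement g & used_pieces g == Q]| = #|I| ^_ #|Q|.
Proof.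
have -> : [set g : {ffun I -> X} | placement g & used_pieces g == Q]
    = [set place h | h in [pred h : {ffun _ -> _} | injectiveb h]].
  apply/setP=> g; rewrite inE; apply/andP/imsetP=> [[Pg /eqP Qg]|[h hi ->]].
    by have [h hi ->] := place_onto Pg Qg; exists h.
  exact/andP/placeP.
rewrite (card_in_imset place_inj) -cardsE card_inj_ffuns; congr (_ ^_ _).
by rewrite card_sig.
Qed.

End Fiber.

(** Sort the placements by their set of nonempty pieces, then these sets by
    cardinality. *)
Lemma card_placements :
  #|[set g : {ffun I -> X} | placement g]|
  = \sum_(k < #|T|.+1)
      #|[set Q : {set X} | exact_cover Q & #|Q| == k]| * #|I| ^_ k.
Proof.
rewrite -sum1dep_card (partition_big (@used_pieces I) exact_cover) /=; last first.
  exact: used_pieces_cover.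
pose bl (Q : {set X}) : 'I_#|T|.+1 := inord #|Q|.
rewrite (partition_big bl xpredT) //=; apply: eq_bigr => k _.
rewrite -sum1dep_card big_distrl /=; apply: eq_big => Q.
  apply: andb_id2l => QC.
  by rewrite -val_eqE /= inordK // ltnS exact_cover_card.
move=> /andP[QC /eqP <-]; rewrite sum1dep_card card_placements_using //.
by rewrite mul1n inordK // ltnS exact_cover_card.
Qed.

End Poles.

End DoubleCount.

(** * Set partitions *)

Section Stirling.

Local Open Scope nat_scope.

Lemma partition_exact_cover (T : finType) (P : {set {set T}}) :
  partition P [set: T] = exact_cover id predT set0 P.
Proof.
apply/and3P/andP=> [[/eqP covP /trivIsetP trivP P0]|[/forall_inP P0 /forallP covP]].
  split; first by apply/forall_inP=> A AP; apply: contraNneq P0 => <-.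
  apply/forallP=> x; have /bigcupP[A AP xA] : x \in cover P by rewrite covP.
  apply/cards1P; exists A; apply/setP=> B; rewrite !inE.
  apply/andP/eqP=> [[BP xB]|->] //; apply/eqP; apply: contraTT xB => BNA.
  by rewrite (disjointFl (trivP _ _ BP AP BNA)).
split.
- apply/eqP/setP=> x; rewrite [RHS]inE; have /cards1P[A DA] := covP x.
  have /[!inE]/andP[AP xA] : A \in [set A in P | x \in A] by rewrite DA inE.
  by apply/bigcupP; exists A.
- apply/trivIsetP=> A B AP BP; apply: contraNT => /pred0Pn[x /andP[/= xA xB]].
  have /cards1P[C DC] := covP x.
  have: A \in [set A in P | x \in A] by rewrite inE AP.
  have: B \in [set A in P | x \in A] by rewrite inE BP.
  by rewrite DC !inE => /eqP-> /eqP->.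
- by apply/negP=> /P0 /=; rewrite eqxx.
Qed.

(** The placements of subsets are the fibre families of the functions T -> I. *)
Lemma card_fun_placements (T I : finType) :
  #|[set g : {ffun I -> {set T}} | placement id predT g]| = #|I| ^ #|T|.
Proof.
pose fibers (f : {ffun T -> I}) : {ffun I -> {set T}} :=
  [ffun i => [set x | f x == i]].
have fibers_inj : injective fibers.
  move=> f f' /ffunP eq_ff'; apply/ffunP=> x; apply/esym/eqP.
  have /setP/(_ x) := eq_ff' (f x).
  by rewrite !ffunE !inE eqxx.
rewrite -card_ffun -(card_imset _ fibers_inj); apply: eq_card => g; rewrite inE.
apply/andP/imsetP=> [[_ /forallP cov_g]|[f _ ->]].
  have [f fP] := fin_all_exists (fun x => cards1P (cov_g x)).
  exists (finfun f) => //; apply/ffunP=> i; apply/setP=> x.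
  by have /setP/(_ i) := fP x; rewrite !ffunE !inE ffunE eq_sym.
split; apply/forallP=> // x; apply/cards1P; exists (f x).
by apply/setP=> i; rewrite inE ffunE !inE eq_sym.
Qed.

Lemma sum_S2_ffact n m : \sum_(k < n.+1) S2 n k * m ^_ k = m ^ n.
Proof.
have := @card_placements _ _ id predT (set0 : {set 'I_n}) isT erefl
          (fun=> fun=> id) 'I_m.
rewrite card_fun_placements !card_ord => ->; apply: eq_bigr => k _.
congr (_ * _); apply: eq_card => P; rewrite !inE.
by rewrite partition_exact_cover.
Qed.

End Stirling.

(** * Ordered partitions *)

Section Lah.

Local Open Scope nat_scope.

Variable T : finType.
Notation N := #|T|.

Definition bseq_supp (s : {bseq N of T}) : {set T} := [set x in (s : seq T)].
Definition bseq_uniq (s : {bseq N of T}) : bool := uniq s.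

Lemma ordered_partition_exact_cover (Q : {set {bseq N of T}}) :
  ordered_partition Q = exact_cover bseq_supp bseq_uniq [bseq] Q.
Proof.
congr (_ && _); apply: eq_forallb => x.
  by rewrite andbC lt0n size_eq0 -val_eqE.
by congr (_ == _); apply: eq_card => s; rewrite !inE.
Qed.

Lemma perm_enum_count (s : seq T) :
  (forall x, count_mem x s = 1) -> uniq s /\ size s = N.
Proof.
move=> s1.
have s_all x : x \in s by rewrite -has_pred1 has_count s1.
have us : uniq s by apply: count_mem_uniq => x; rewrite s1 s_all.
split=> //; rewrite cardT; apply/perm_size/uniq_perm => //.
  exact: enum_uniq.
by move=> x; rewrite s_all mem_enum.
Qed.

Section Flags.

Variable m : nat.

Definition lists (g : {ffun 'I_m -> {bseq N of T}}) : seq (seq T) :=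
  [seq (g i : seq T) | i <- enum 'I_m].

Lemma size_lists g : size (lists g) = m.
Proof. by rewrite size_map size_enum_ord. Qed.

Lemma nth_lists g (i : 'I_m) : nth [::] (lists g) i = g i.
Proof. by rewrite (nth_map i) ?size_enum_ord // nth_ord_enum. Qed.

Lemma count_flatten_lists g x :
  count_mem x (flatten (lists g)) = \sum_i count_mem x (g i).
Proof. by rewrite count_flatten sumnE !big_map. Qed.

(** A point occurs in the concatenation as often as in all the lists together, so
    both sides say that every point occurs once in all. *)
Lemma placement_flatten g :
  placement bseq_supp bseq_uniq g
  = uniq (flatten (lists g)) && (size (flatten (lists g)) == N).
Proof.
apply/andP/andP=> [[/forallP ug /forallP cov_g]|[us /eqP sz]].
  have [|us ->] := @perm_enum_count (flatten (lists g)); last by [].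
  move=> x; rewrite count_flatten_lists -[RHS](eqP (cov_g x)) -sum1dep_card.
  rewrite [RHS]big_mkcond; apply: eq_bigr => i _.
  by rewrite count_uniq_mem ?inE; [case: ifP | apply: ug].
have c1 x : \sum_i count_mem x (g i) = 1.
  rewrite -count_flatten_lists count_uniq_mem //.
  have [|//|_ ->] := @uniq_min_size _ (flatten (lists g)) (enum T) us.
    by move=> y _; rewrite mem_enum.
    by rewrite sz -cardT.
  by rewrite mem_enum.
have ug i : uniq (g i).
  apply: count_mem_uniq => x; have := c1 x; rewrite (bigD1 i) //= => c1x.
  by rewrite -has_pred1 has_count; move: c1x; case: (count _ _) => [|[|k]].
split; apply/forallP=> // x.
rewrite -[X in _ == X](c1 x) -sum1dep_card big_mkcond; apply/eqP.
by apply: eq_bigr => i _; rewrite count_uniq_mem ?inE //; case: ifP.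
Qed.

(** [insub_bseq] returns its argument when the lengths p.2 add up to N; otherwise
    a list could be too long for the type, and a default replaces it. *)
Definition cut (p : N.-tuple T * m.-tuple 'I_N.+1) : {ffun 'I_m -> {bseq N of T}} :=
  [ffun i : 'I_m => insub_bseq N (nth [::] (reshape (map val p.2) p.1) i)].

Definition arrangements : {set N.-tuple T * m.-tuple 'I_N.+1} :=
  setX [set t : N.-tuple T | uniq t] [set c : m.-tuple 'I_N.+1 | \sum_(i <- c) i == N].

Lemma lists_cut p : p \in arrangements ->
  lists (cut p) = reshape (map val p.2) p.1.
Proof.
case: p => t c; rewrite !inE /= => /andP[_ /eqP sum_c].
have sum_c' : sumn (map val c) = N by rewrite sumnE big_map.
have sz : size (reshape (map val c) t) = m by rewrite size_reshape size_map size_tuple.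
apply: (@eq_from_nth _ [::]) => [|i]; rewrite size_lists ?sz // => im.
rewrite (nth_lists (cut (t, c)) (Ordinal im)) ffunE /= insubdK //.
rewrite unfold_in -(nth_map _ 0) ?sz // -/(shape _) reshapeKl; last first.
  by rewrite sum_c' size_tuple.
by rewrite (nth_map ord0) ?size_tuple // -ltnS.
Qed.

Lemma arrangementP t c :
  (t, c) \in arrangements -> uniq t /\ sumn (map val c) = N.
Proof. by rewrite !inE sumnE big_map => /andP[? /eqP]. Qed.

Lemma cut_inj : {in arrangements &, injective cut}.
Proof.
move=> [t c] [t' c'] Ap Ap' /(congr1 lists); rewrite !lists_cut //= => eq_l.
have [_ sc] := arrangementP Ap; have [_ sc'] := arrangementP Ap'.
congr (_, _); apply: val_inj => /=.
  by have := congr1 flatten eq_l; rewrite !reshapeKr ?size_tuple ?sc ?sc'.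
have := congr1 shape eq_l; rewrite !reshapeKl ?size_tuple ?sc ?sc' //.
exact/inj_map/val_inj.
Qed.

(** The inverse of [cut] sends a placement to the concatenation of its lists and
    their lengths. *)
Lemma cut_placement g :
  placement bseq_supp bseq_uniq g = (g \in cut @: arrangements).
Proof.
rewrite placement_flatten; apply/idP/imsetP=> [/andP[us /eqP sz]|[[t c] Ap ->]].
  pose t := tcast sz (in_tuple (flatten (lists g))).
  pose c := [tuple Ordinal (size_bseq (g i) : size (g i) < N.+1) | i < m].
  have ec : map val c = shape (lists g).
    by rewrite /= /lists /shape -!map_comp; apply: eq_map.
  have et : tval t = flatten (lists g) by rewrite val_tcast.
  exists (t, c).
    by rewrite !inE et us /= -(big_map val xpredT id) ec -sumnE -size_flatten sz /=.
  apply/ffunP=> i; apply: val_inj.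
  by rewrite ffunE /= et ec flattenK nth_lists insubdK ?unfold_in ?size_bseq.
have [us sc] := arrangementP Ap.
by rewrite lists_cut // reshapeKr ?size_tuple ?sc // us eqxx.
Qed.

End Flags.

(** The right-hand side is N! times the number of compositions of N into m parts,
    i.e., m (m + 1) ... (m + N - 1); when m = N = 0 the truncated predecessor is
    harmless, as the falling factorial of length 0 is 1. *)
Lemma card_list_placements m :
  #|[set g : {ffun 'I_m -> {bseq N of T}} | placement bseq_supp bseq_uniq g]|
  = (m + N).-1 ^_ N.
Proof.
under eq_finset => g do rewrite cut_placement.
rewrite cardsE card_in_imset; last exact: cut_inj.
rewrite cardsX.
have -> : #|[set t : N.-tuple T | uniq t]| = N`!.
  rewrite -ffactnn -(card_uniq_tuples N (@predT T)); apply: eq_card => t.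
  by rewrite !inE all_predT.
case: m => [|m]; last first.
  by rewrite card_ord_partitions -bin_ffact mulnC -(bin_sub (leq_addl m N)) addnK.
(* Without poles the composition is empty, so it sums to N only when N = 0. *)
have -> : #|[set c : 0.-tuple 'I_N.+1 | \sum_(i <- c) i == N]| = (N == 0).
  have sum0 (c : 0.-tuple 'I_N.+1) : \sum_(i <- c) i = 0 by rewrite tuple0 big_nil.
  have [N0|NN0] := eqVneq N 0.
    have -> : [set c : 0.-tuple 'I_N.+1 | \sum_(i <- c) i == N] = setT.
      by apply/setP=> c; rewrite !inE sum0 N0.
    by rewrite cardsT card_tuple expn0.
  by apply: eq_card0 => c; rewrite !inE sum0 eq_sym (negPf NN0).
by rewrite add0n; case: N => // n; rewrite muln0 ffact_small.
Qed.

(** The equation N = n lets T := 'I_n be counted by n, while the type of the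
    sequences still depends on #|T|. *)
Lemma sum_ordered_partitions_ffact n m : N = n ->
  \sum_(k < n.+1)
    #|[set Q : {set {bseq N of T}} | ordered_partition Q & #|Q| == k]| * m ^_ k
  = (m + n).-1 ^_ n.
Proof.
have supp0 : bseq_supp [bseq] = set0 by apply/setP=> x; rewrite !inE.
have supp_nil s : bseq_uniq s -> bseq_supp s = set0 -> s = [bseq].
  move=> _ /setP s0; apply/val_inj; case Ds: (val s) => [//|x r].
  by have := s0 x; rewrite !inE [bseqval s]Ds inE eqxx.
have := @card_placements _ _ bseq_supp bseq_uniq [bseq] isT supp0 supp_nil 'I_m.
rewrite card_list_placements card_ord => cardE <-; rewrite cardE.
apply: eq_bigr => k _; congr (_ * _); apply: eq_card => Q; rewrite !inE.
by rewrite ordered_partition_exact_cover.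
Qed.

End Lah.

Lemma sum_Lah_ffact n m : (\sum_(k < n.+1) Lah n k * m ^_ k = (m + n).-1 ^_ n)%N.
Proof. exact/sum_ordered_partitions_ffact/card_ord. Qed.

(** * The numerical identities over the integers *)

Lemma horner_falling (x : int) k : (falling 'X k).[x] = falling x k.
Proof.
rewrite horner_prod; apply: eq_bigr => i _.
by rewrite -polyC_natr !hornerE.
Qed.

(** Changing the sign of each factor of (-m)_n gives m (m + 1) ... (m + n - 1),
    the factors of the right-hand side in reverse order. *)
Lemma falling_opp_nat m n : falling (- m%:Z) n = (-1) ^+ n * ((m + n).-1 ^_ n)%:Z.
Proof.
rewrite /falling ffact_prod -[Posz (\prod_(i < n) _)]natz natr_prod.
rewrite (reindex_inj rev_ord_inj) /=.
rewrite -[X in (-1) ^+ X](card_ord n) -prodrN; apply: eq_bigr => i _.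
by have := ltn_ord i; rewrite !natz; lia.
Qed.

Lemma falling_S1 (x : int) n : falling x n = \sum_(k < n.+1) S1 n k * x ^+ k.
Proof.
rewrite -horner_falling fallingX_S1 horner_sum.
by apply: eq_bigr => k _; rewrite !hornerE.
Qed.

Lemma sum_S2_ffactz n m : \sum_(k < n.+1) (S2 n k)%:Z * (m ^_ k)%:Z = m%:Z ^+ n.
Proof.
rewrite -[m%:Z]natz -natrX -(sum_S2_ffact n m) natr_sum.
by apply: eq_bigr => k _; rewrite natrM !natz.
Qed.

Lemma sum_Lah_ffactz n m :
  \sum_(k < n.+1) (Lah n k)%:Z * (m ^_ k)%:Z = (-1) ^+ n * falling (- m%:Z) n.
Proof.
rewrite falling_opp_nat signrMK -(sum_Lah_ffact n m) -[RHS]natz natr_sum.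
by apply: eq_bigr => k _; rewrite natrM !natz.
Qed.

Lemma falling_nat m k : falling (m%:Z) k = (m ^_ k)%:Z.
Proof.
rewrite /falling; have [mk|km] := ltnP m k.
  rewrite ffact_small //; apply/eqP; rewrite prodf_seq_eq0; apply/hasP.
  by exists (Ordinal mk); rewrite ?mem_index_enum //= natz subrr.
rewrite ffact_prod -[RHS]natz natr_prod; apply: eq_bigr => i _.
by rewrite natrB ?natz // ltnW // (leq_trans (ltn_ord i)).
Qed.

Lemma poly_eq_nat (p q : {poly int}) :
  (forall m : nat, p.[m%:Z] = q.[m%:Z]) -> p = q.
Proof.
move=> eq_pq; apply/eqP; rewrite -subr_eq0; apply: contraT => nz.
suff: (size (map Posz (iota 0 (size (p - q)%R))) < size (p - q)%R)%N.
  by rewrite size_map size_iota ltnn.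
apply: max_poly_roots => //.
  by apply/allP=> _ /mapP[m _ ->]; rewrite rootE !hornerE eq_pq subrr.
by rewrite map_inj_uniq ?iota_uniq // => ? ? [].
Qed.

(** The count only gives this at the natural numbers; the expansion of (-m)^n
    needs it at negative integers. *)
Lemma sum_S2_falling n (x : int) :
  \sum_(k < n.+1) (S2 n k)%:Z * falling x k = x ^+ n.
Proof.
rewrite -hornerXn.
have <- : \sum_(k < n.+1) (S2 n k)%:Z *: falling 'X k = 'X^n :> {poly int}.
  apply: poly_eq_nat => m; rewrite horner_sum hornerXn -sum_S2_ffactz.
  by apply: eq_bigr => k _; rewrite hornerZ horner_falling falling_nat.
by rewrite horner_sum; apply: eq_bigr => k _; rewrite hornerZ horner_falling.
Qed.

Lemma sign_sub n k : (k <= n)%N -> (-1) ^+ (n - k) = (-1) ^+ n * (-1) ^+ k :> int.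
Proof. by move=> kn; rewrite -exprD -signr_odd oddB // -oddD signr_odd. Qed.

(** * Replacing falling factorials by an arbitrary sequence *)

(** The matrix of the (m)_j is triangular, with the nonzero diagonal entries k!:
    evaluation at m = k determines a_k from the a_j with j < k. *)
Lemma ffact_coef_eq N (a b : nat -> int) :
    (forall m, \sum_(j < N) a j * (m ^_ j)%:Z = \sum_(j < N) b j * (m ^_ j)%:Z) ->
  forall j, (j < N)%N -> a j = b j.
Proof.
move=> eq_ab; elim/ltn_ind=> k IHk kN; have := eq_ab k.
rewrite (bigD1 (Ordinal kN)) // [in RHS](bigD1 (Ordinal kN)) //= ffactnn.
rewrite (eq_bigr (fun j : 'I_N => b j * (k ^_ j)%:Z)) => [/addIr|j].
  by apply: mulIf; have := fact_gt0 k; lia.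
rewrite -val_eqE /= => jNk; have [jk|kj] := ltnP j k; first by rewrite IHk.
by rewrite ffact_small ?mulr0 //; lia.
Qed.

(** A linear relation between falling factorials that holds at all natural
    numbers is an equality of coefficients, hence survives the linear map
    (m)_j |-> w_j. *)
Lemma umbral_transfer (S : pzRingType) (w : nat -> S) n
    (a : nat -> nat) (c : nat -> int) (B : nat -> nat -> nat) :
    (forall m, \sum_(j < n.+1) (a j)%:Z * (m ^_ j)%:Z
       = \sum_(k < n.+1) c k * \sum_(j < k.+1) (B k j)%:Z * (m ^_ j)%:Z) ->
  \sum_(j < n.+1) (a j)%:R * w j
    = \sum_(k < n.+1) (c k)%:~R * \sum_(j < k.+1) (B k j)%:R * w j.
Proof.
(* The coefficient of w_j on the right-hand side. *)
pose d j : int := \sum_(k < n.+1 | (j < k.+1)%N) c k * (B k j)%:Z.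
have collect (S' : pzRingType) (v : nat -> S') :
    \sum_(k < n.+1) (c k)%:~R * \sum_(j < k.+1) (B k j)%:R * v j
    = \sum_(j < n.+1) (d j)%:~R * v j.
  under eq_bigr => k _.
    rewrite (big_ord_widen n.+1 (fun j => (B k j)%:R * v j)) ?ltn_ord //.
    rewrite big_distrr /=; over.
  rewrite (exchange_big_dep xpredT) //=; apply: eq_bigr => j _.
  rewrite rmorph_sum big_distrl; apply: eq_bigr => k _ /=.
  by rewrite mulrA intrM.
move=> eq_m; rewrite collect; apply: eq_bigr => j _; congr (_ * _).
suff -> : d j = (a j)%:Z by [].
apply/esym/(@ffact_coef_eq n.+1 (fun j => (a j)%:Z)) => // m; rewrite eq_m.
have := collect _ (fun j => (m ^_ j)%:Z).
under eq_bigr => k _ do rewrite intz.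
under [RHS]eq_bigr => k _ do rewrite intz.
move=> <-; apply: eq_bigr => k _; congr (_ * _).
by apply: eq_bigr => i _; rewrite natz.
Qed.

Theorem theorem13 (R : comNzRingType) (n : nat) :
  lahbell2 R n
    = \sum_(k < n.+1) (-1) ^+ (n - k) * (S1 n k)%:~R * bell2 R k
  /\
  bell2 R n
    = \sum_(k < n.+1) (-1) ^+ (n - k) * (S2 n k)%:R * lahbell2 R k.
Proof.
pose w k : {mpoly R[2]} := falling 'X_0 k * 'X_1 ^+ k.
have bellE k : bell2 R k = \sum_(j < k.+1) (S2 k j)%:R * w j.
  by apply: eq_bigr => j _; rewrite mulrA.
have lahE k : lahbell2 R k = \sum_(j < k.+1) (Lah k j)%:R * w j.
  by apply: eq_bigr => j _; rewrite mulrA.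
split.
  rewrite lahE (umbral_transfer w (c := fun k => (-1) ^+ (n - k) * S1 n k) (B := S2)).
    by apply: eq_bigr => k _; rewrite bellE rmorphM rmorphXn rmorphN1.
  (* Both sides are (-1)^n (-m)_n, expanded in powers of -m on the right. *)
  move=> m; rewrite sum_Lah_ffactz falling_S1 big_distrr; apply: eq_bigr => k _ /=.
  rewrite sum_S2_ffactz sign_sub; last by rewrite -ltnS.
  rewrite [(- m%:Z) ^+ k]exprNn.
  by rewrite -!mulrA; congr (_ * _); rewrite mulrCA.
rewrite bellE (umbral_transfer w (c := fun k => (-1) ^+ (n - k) * (S2 n k)%:Z) (B := Lah)).
  by apply: eq_bigr => k _; rewrite lahE rmorphM rmorphXn rmorphN1.
(* Both sides are m^n = (-1)^n (-m)^n, with (-m)^n expanded in the (-m)_k. *)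
move=> m; rewrite sum_S2_ffactz -[m%:Z]opprK exprNn -(sum_S2_falling n (- m%:Z)) big_distrr.
apply: eq_bigr => k _ /=; rewrite sum_Lah_ffactz sign_sub; last by rewrite -ltnS.
rewrite -!mulrA; congr (_ * _).
by rewrite [RHS]mulrCA signrMK.
Qed.
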